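(* Let $\mathbb{F}_q$ be a finite field, $\mathcal{V}$ a vector space over $\mathbb{F}_q$, and $k,t$ integers with $0\le t\le k$. Let $n\ge 2$ and let $\mathcal{C}=\{\pi_1,\ldots,\pi_n\}$ be a $(k,k-t)$-SCID in $\mathcal{V}$. Define $S:=\langle \pi_1,\ldots,\pi_n\rangle$ and $I:=\langle \pi_i\cap\pi_j \mid 1\le i<j\le n\rangle$. Then \[\dim S+\dim I\le nk.\]
   Context: A $(k,k-t)$-SCID is a set of (distinct) $k$-dimensional subspaces of $\mathcal{V}$, containing at least two elements, such that any two distinct members intersect in a subspace of dimension exactly $k-t$. $\langle\cdot\rangle$ denotes the span. *)

(* Defs.v *)
From mathcomp Require Import all_boot all_algebra.
From mathcomp Require Import boolp classical_sets.

Set Implicit Arguments.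
Unset Strict Implicit.
Unset Printing Implicit Defensive.

Import GRing.Theory.
Local Open Scope ring_scope.
Local Open Scope classical_set_scope.

(* The ambient space is an arbitrary [lmodType] over a field, not necessarily
   finite dimensional; subspaces are therefore sets rather than [{vspace _}]. *)

Definition subspace (F : fieldType) (V : lmodType F) (U : set V) : Prop :=
  GRing.submod_closed (mem U).

Definition lspan (F : fieldType) (V : lmodType F) (X : set V) : set V :=
  smallest (@subspace F V) X.

Definition lin_independent (F : fieldType) (V : lmodType F) (d : nat)
    (b : 'I_d -> V) : Prop :=
  forall c : 'I_d -> F, \sum_i c i *: b i = 0 -> forall i, c i = 0.

(* [has_dim U d]: [U] is finite dimensional, of dimension [d].  A relation
   avoids a junk value for the dimension of infinite dimensional subspaces. *)
Definition has_dim (F : fieldType) (V : lmodType F) (U : set V) (d : nat)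
    : Prop :=
  exists2 b : 'I_d -> V, lin_independent b & lspan (range b) = U.


Definition SCID (F : fieldType) (V : lmodType F) (k m : nat)
    (C : set (set V)) : Prop :=
  [/\ forall A, C A -> subspace A /\ has_dim A k,
      exists A B, [/\ C A, C B & A <> B]
    & forall A B, C A -> C B -> A <> B -> has_dim (A `&` B) m].

(* Main.v *)
(** Add the subspaces one at a time.  Let [S'] and [I'] be the two spans for
    the members treated so far and let [P] be the next member.  Then
    [dim (S' + P) = dim S' + dim P - dim (S' :&: P)], whereas [I'] grows by a
    span of intersections [P_i :&: P], all contained in [S' :&: P].  To compute
    with [{vspace _}], the members are pulled back along an injective linear
    map from a finite dimensional space whose range contains them all. *)

Require Import Defs.
From HB Require Import structures.
From mathcomp Require Import all_boot all_algebra.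
From mathcomp Require Import boolp classical_sets.

Set Implicit Arguments.
Unset Strict Implicit.
Unset Printing Implicit Defensive.

Import GRing.Theory.
Local Open Scope ring_scope.
Local Open Scope classical_set_scope.

Lemma dim_sumv_pairwise_cap (F : fieldType) (vT : vectType F) (n : nat)
    (P : 'I_n -> {vspace vT}) :
  (\dim (\sum_i P i)%VS +
     \dim (\sum_(j < n) \sum_(i < n | (i < j)%N) (P i :&: P j))%VS
   <= \sum_i \dim (P i))%N.
Proof.
elim: n P => [|n IHn] P; first by rewrite !big_ord0 dimv0.
pose P' i := P (widen_ord (leqnSn n) i); pose p := P ord_max.
pose S := (\sum_i P' i)%VS; pose J := (\sum_(i < n) (P' i :&: p))%VS.
pose I := (\sum_(j < n) \sum_(i < n | (i < j)%N) (P' i :&: P' j))%VS.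
(* The new outer index contributes exactly [J]. For an old [j] the new inner index is never below
   [j], so its term is the zero space and the old sum [I] remains. *)
have -> : (\sum_(j < n.+1) \sum_(i < n.+1 | (i < j)%N) (P i :&: P j) = I + J)%VS.
  rewrite big_ord_recr; congr (_ + _)%VS.
    apply: eq_bigr => j _; rewrite big_mkcond big_ord_recr -big_mkcond /=.
    by rewrite ltnNge (ltnW (ltn_ord j)) addv0.
  rewrite big_mkcond big_ord_recr /= ltnn addv0.
  by apply: eq_bigr => i _; rewrite ltn_ord.
rewrite !big_ord_recr -/S -/p /=.
have sJ : (J <= S :&: p)%VS.
  apply/subv_sumP => i _; apply: capvS => //.
  exact: (sumv_sup i).
have dIJ : (\dim (I + J)%VS <= \dim I + \dim (S :&: p)%VS)%N.
  apply: leq_trans (_ : \dim I + \dim J <= _)%N.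
    by rewrite -dimv_sum_cap leq_addr.
  by rewrite leq_add2l dimvS.
apply: (leq_trans (leq_add (leqnn _) dIJ)).
(* The bound [\dim (S :&: p)] on the growth of [I] is exactly what [S + p] loses against
   [\dim S + \dim p]. After the dimension formula only [\dim p] is added to both sides of the
   induction hypothesis. *)
by rewrite addnA addnAC dimv_sum_cap addnAC leq_add2r; apply: IHn.
Qed.

Section Subspace.
Variables (F : fieldType) (V : lmodType F).
Implicit Types (U X : set V).

Lemma subspaceP U :
  subspace U <-> U 0 /\ forall a u v, U u -> U v -> U (a *: u + v).
Proof.
split=> [[U0 UL]|[U0 UL]]; split.
- by move: U0; rewrite inE.
- by move=> a u v Uu Uv; move: (UL a u v); rewrite !inE; apply.
- by rewrite inE.
- by move=> a u v; rewrite !inE; apply: UL.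
Qed.

Lemma subspace0 U : subspace U -> U 0.
Proof. by case/subspaceP. Qed.

Lemma subspaceL U a u v : subspace U -> U u -> U v -> U (a *: u + v).
Proof. by case/subspaceP=> _; apply. Qed.

Lemma subspaceD U u v : subspace U -> U u -> U v -> U (u + v).
Proof. by move=> sU Uu Uv; rewrite -[u]scale1r; apply: subspaceL. Qed.

Lemma subspaceZ U a u : subspace U -> U u -> U (a *: u).
Proof.
by move=> sU Uu; rewrite -[a *: u]addr0; apply: subspaceL => //; apply: subspace0.
Qed.

Lemma subspace_sum U (I : Type) (r : seq I) (P : pred I) (G : I -> V) :
  subspace U -> (forall i, P i -> U (G i)) -> U (\sum_(i <- r | P i) G i).
Proof.
move=> sU UG; apply: big_ind => //; first exact: subspace0.
by move=> x y; apply: subspaceD.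
Qed.

Lemma sub_lspan X : X `<=` lspan X.
Proof. by move=> x Xx A [_]; apply. Qed.

Lemma lspan_sub X U : subspace U -> X `<=` U -> lspan X `<=` U.
Proof. by move=> sU XU x; apply; split. Qed.

Lemma subspace_lspan X : subspace (lspan X).
Proof.
apply/subspaceP; split=> [A [sA _]|a u v Xu Xv A XA]; first exact: subspace0.
by apply: subspaceL; [case: XA|apply: Xu|apply: Xv].
Qed.

End Subspace.

Lemma subspace_image (F : fieldType) (V W : lmodType F) (f : {linear V -> W})
    (U : set V) :
  subspace U -> subspace (f @` U).
Proof.
move=> sU; apply/subspaceP; split.
  by exists 0; [apply: subspace0|rewrite linear0].
move=> a _ _ [u Uu <-] [v Uv <-].
by exists (a *: u + v); [apply: subspaceL|rewrite linearP].
Qed.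

Lemma subspace_preimage (F : fieldType) (V W : lmodType F) (f : {linear V -> W})
    (U : set W) :
  subspace U -> subspace (f @^-1` U).
Proof.
move=> sU; apply/subspaceP; split=> [|a u v Uu Uv] /=.
  by rewrite linear0; apply: subspace0.
by rewrite linearP; apply: subspaceL.
Qed.

Section VectorSubspace.
Variables (F : fieldType) (vT : vectType F).

Lemma subspace_vspace (P : {vspace vT}) : subspace [set x | x \in P].
Proof.
by apply/subspaceP; split=> [|a u v Pu Pv] /=; rewrite ?mem0v ?memvD ?memvZ.
Qed.

(** Among the [{vspace vT}] contained in [U], one of maximal dimension is all of [U]: adjoining the
    line through any [x] in [U] stays inside [U], so it cannot raise the dimension. *)
Lemma vspace_of_subspace (U : set vT) :
  subspace U -> exists P : {vspace vT}, U = [set x | x \in P].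
Proof.
move=> sU.
pose Q d := `[< exists2 P : {vspace vT}, \dim P = d & [set x | x \in P] `<=` U >].
have exQ : exists d, Q d.
  exists 0%N; apply/asboolP; exists 0%VS; first exact: dimv0.
  by move=> x /=; rewrite memv0 => /eqP ->; apply: subspace0.
have boundQ d : Q d -> (d <= \dim {:vT})%N.
  by move=> /asboolP[P <- _]; apply: dimvS; apply: subvf.
case: (ex_maxnP exQ boundQ) => d /asboolP[P dP PU] maxd.
exists P; apply/seteqP; split=> // x Ux /=.
have PxU : [set y | y \in (P + <[x]>)%VS] `<=` U.
  move=> _ /memv_addP[u Pu [_ /vlineP[a ->] ->]].
  by apply: subspaceD => //; [apply: PU|apply: subspaceZ].
have dPx : (\dim (P + <[x]>)%VS <= \dim P)%N.
  by rewrite dP; apply: maxd; apply/asboolP; exists (P + <[x]>)%VS.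
have /eqP -> : P == (P + <[x]>)%VS by rewrite eqEdim addvSl.
by rewrite memvE addvSr.
Qed.

End VectorSubspace.

Section Embedding.
Variables (F : fieldType) (V : lmodType F).

Lemma lin_comb_linear (N : nat) (g : 'I_N -> V) :
  linear (fun r : 'rV[F]_N => \sum_i r 0 i *: g i).
Proof.
move=> a u v; rewrite scaler_sumr -big_split; apply: eq_bigr => i _ /=.
by rewrite !mxE scalerDl scalerA.
Qed.

(** The linear combination map from row vectors reaches every [g i] but may have a kernel [K].
    Restricting it to a complement of [K] makes it injective and keeps its range. *)
Lemma finite_family_embedding (N : nat) (g : 'I_N -> V) :
  exists (vT : vectType F) (f : {linear vT -> V}),
    injective f /\ range g `<=` range f.
Proof.
pose h0 (r : 'rV[F]_N) := \sum_i r 0 i *: g i.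
pose hL := GRing.isLinear.Build _ _ _ _ h0 (lin_comb_linear g).
pose h : {linear 'rV[F]_N -> V} := HB.pack h0 hL.
have s0 : subspace [set 0 : V].
  by apply/subspaceP; split=> // a u v -> ->; rewrite scaler0 addr0.
have [K hK] := vspace_of_subspace (subspace_preimage h s0).
have kerP x : h x = 0 <-> x \in K.
  by have := congr1 (fun A : set _ => A x) hK => /= ->.
exists (subvs_of K^C%VS).
exists (h \o (vsval : {linear subvs_of K^C%VS -> 'rV[F]_N}) : {linear _ -> _}).
split.
  move=> x y exy.
  have /kerP xyK : h (vsval x - vsval y) = 0.
    by rewrite linearB; apply/eqP; rewrite subr_eq0; apply/eqP.
  apply/val_inj/eqP; rewrite -subr_eq0 -memv0 -(capv_compl K) memv_cap xyK /=.
  by rewrite rpredB // subvsP.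
move=> _ [i _ <-].
(* The unit row vector maps to [g i]. Its component in [K] is killed, so its component in [K^C] is
   already a preimage of [g i]. *)
have : delta_mx 0 i \in (K + K^C)%VS by rewrite addv_complf memvf.
case/memv_addP=> u uK [w wK e].
exists (Subvs wK) => //=.
have <- : h (delta_mx 0 i) = g i.
  rewrite /= /h0 (bigD1 i) //= mxE !eqxx scale1r big1 ?addr0 // => j ji.
  by rewrite mxE (negPf ji) scale0r.
by rewrite e linearD (iffRL (kerP u)) // add0r.
Qed.

Lemma has_dim_image (vT : vectType F) (f : {linear vT -> V}) (P : {vspace vT}) :
  injective f -> has_dim (f @` [set x | x \in P]) (\dim P).
Proof.
move=> f_inj; exists (fun i => f (vbasis P)`_i).
  move=> c c0; have /freeP := basis_free (vbasisP P); apply.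
  by apply: f_inj; rewrite linear0 linear_sum -[RHS]c0; apply: eq_bigr => i _;
    rewrite linearZ.
apply/seteqP; split.
  apply: lspan_sub; first exact: subspace_image (subspace_vspace P).
  move=> _ [i _ <-]; exists (vbasis P)`_i => //=.
  by rewrite vbasis_mem // mem_nth // size_tuple.
move=> _ [x /= Px <-]; rewrite (coord_vbasis Px) linear_sum.
apply: subspace_sum => [|i _]; first exact: subspace_lspan.
rewrite linearZ; apply: (subspaceZ _ (@subspace_lspan _ _ _)).
by apply: sub_lspan; exists i.
Qed.

(** Preimages of the [b i] span a space [C] of dimension at most [k], and injectivity of [f] carries
    the inclusion of images back to [P <= C]. *)
Lemma dim_preimage_le (vT : vectType F) (f : {linear vT -> V})
    (P : {vspace vT}) (k : nat) (b : 'I_k -> V) :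
  injective f -> range b `<=` range f ->
  f @` [set x | x \in P] `<=` lspan (range b) -> (\dim P <= k)%N.
Proof.
move=> f_inj bf Pb.
have /fin_all_exists[c fc] i : exists x, f x = b i.
  by have [|x _ <-] := bf (b i); [exists i|exists x].
pose C := <<[tuple c i | i < k]>>%VS.
have bC : range b `<=` f @` [set y | y \in C].
  move=> _ [i _ <-]; exists (c i) => //=.
  by apply: memv_span; apply/tnthP; exists i; rewrite tnth_mktuple.
have sPC : (P <= C)%VS.
  apply/subvP => x Px.
  have sC := subspace_image f (subspace_vspace C).
  have [|y Cy /f_inj <- //] := lspan_sub sC bC (Pb (f x) _).
  by exists x.
by apply: leq_trans (dimvS sPC) (leq_trans (dim_span _) _); rewrite size_tuple.
Qed.

End Embedding.

Theorem theorem1 (F : finFieldType) (V : lmodType F) (k t : nat)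
    (htk : (t <= k)%N) (n : nat) (hn : (2 <= n)%N)
    (pi : 'I_n -> set V) (pi_inj : injective pi)
    (hC : SCID k (k - t)%N (range pi)) :
  let S := lspan (\bigcup_i pi i) in
  let I := lspan (\bigcup_(p in [set p : 'I_n * 'I_n | (p.1 < p.2)%N])
                    (pi p.1 `&` pi p.2)) in
  exists dS dI : nat,
    [/\ has_dim S dS, has_dim I dI & (dS + dI <= n * k)%N].
Proof.
move=> S I; case: hC => hC _ _.
have spi i : subspace (pi i) by case: (hC (pi i)); first exists i.
have /fin_all_exists[b hb] i : exists b : 'I_k -> V, lspan (range b) = pi i.
  by have [|_ [b _ <-]] := hC (pi i); [exists i|exists b].
(* The spanning vectors of all members are listed as one finite family, so that a single embedding
   [f] serves every [pi i]. *)
pose g (m : 'I_#|{: 'I_n * 'I_k}|) := b (enum_val m).1 (enum_val m).2.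
have [vT [f [f_inj gf]]] := finite_family_embedding g.
have bf i : range (b i) `<=` range f.
  move=> _ [j _ <-]; apply: gf; exists (enum_rank (i, j)) => //.
  by rewrite /g enum_rankK.
have pif i : pi i `<=` range f.
  by rewrite -hb; apply: lspan_sub => //; apply: subspace_image; apply/subspaceP.
have /fin_all_exists[P hP] i : exists P : {vspace vT},
    f @^-1` pi i = [set x | x \in P].
  exact/vspace_of_subspace/subspace_preimage.
have memP i x : x \in P i <-> pi i (f x).
  by have := congr1 (fun A : set _ => A x) (hP i) => /= ->.
exists (\dim (\sum_i P i)%VS).
exists (\dim (\sum_(j < n) \sum_(i < n | (i < j)%N) (P i :&: P j))%VS); split.
- suff -> : S = f @` [set x | x \in (\sum_i P i)%VS] by apply: has_dim_image.
  apply/seteqP; split.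
    apply: lspan_sub; first exact: subspace_image (subspace_vspace _).
    (* Since [f] reaches all of [pi i], the vector [v] has a preimage, which lies in [P i] by the
       choice of [P i]. *)
    move=> v [i _ pv]; have [x _ fx] := pif i v pv.
    exists x => //=; apply: (subvP (sumv_sup i _ (subvv _))) => //.
    by apply/memP; rewrite fx.
  move=> _ [x /= /memv_sumP[v vP ->] <-]; rewrite linear_sum.
  apply: subspace_sum => [|i _]; first exact: subspace_lspan.
  by apply: sub_lspan; exists i => //; apply/memP/vP.
- set J := (\sum_j _)%VS.
  suff -> : I = f @` [set x | x \in J] by apply: has_dim_image.
  apply/seteqP; split.
    apply: lspan_sub; first exact: subspace_image (subspace_vspace _).
    move=> v [[i j] /= ij [pv qv]]; have [x _ fx] := pif i v pv.
    exists x => //=.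
    have sJ : (P i :&: P j <= J)%VS.
      by apply: (sumv_sup j) => //; apply: (sumv_sup i).
    by apply: (subvP sJ); rewrite memv_cap; apply/andP; split; apply/memP;
      rewrite fx.
  (* The double sum is decomposed twice, first over [j] and then over [i < j], until each summand
     maps into a single [pi i] and [pi j]. *)
  move=> _ [x /= /memv_sumP[v vP ->] <-]; rewrite linear_sum.
  apply: subspace_sum => [|j _]; first exact: subspace_lspan.
  have /memv_sumP[w wP ->] := vP j isT; rewrite linear_sum.
  apply: subspace_sum => [|i ij]; first exact: subspace_lspan.
  have := wP i ij; rewrite memv_cap => /andP[/memP wi /memP wj].
  by apply: sub_lspan; exists (i, j).
- apply: leq_trans (dim_sumv_pairwise_cap P) _.
  apply: (@leq_trans (\sum_(i < n) k)%N); last by rewrite sum_nat_const card_ord.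
  (* Each [P i] maps into [pi i], which is spanned by [k] vectors in the range of [f], so the sum of
     the dimensions is at most [n * k]. *)
  apply: leq_sum => i _; apply: (@dim_preimage_le _ _ _ f _ _ (b i)) => //.
  by rewrite hb => _ [x /memP px <-].
Qed.
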